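(* Let $\mathbf V$ be a finite-dimensional real Lie algebra with basis $(v^i)$ and bracket $[v^i,v^j]=C^{ij}_k v^k$, and let $\langle h^1\rangle\oplus\mathbf V$ be the central extension $$[h^1,v]=0\ \ \forall v\in\mathbf V,\qquad [v^i,v^j]=\Omega_0^{ij}h^1+C^{ij}_kv^k,\tag{E}$$ where $\Omega_0=(\Omega_0^{ij})$ is an antisymmetric matrix defining a Lie algebra 2-cocycle of $\mathbf V$. Let $\alpha,\beta$ be two commuting derivations of $\mathbf V$, and denote also by $\alpha,\beta$ their matrices $(\alpha^i_j)$, $(\beta^i_j)$ defined by $\alpha(v^i)=\alpha^i_jv^j$, $\beta(v^i)=\beta^i_jv^j$. Let $\tilde G=\langle h_1\rangle\oplus\mathbf V^*$ be the Lie group with product $(t h_1,\xi)\ast(t'h_1,\xi')=\big((t+t')h_1,\ e^{t\alpha^*}\xi'+e^{-t'\beta^*}\xi\big)$, equipped with the Lie bialgebra cocycle $\delta$ on its Lie algebra whose dual $\delta^*$ is the bracket (E) on $\langle h^1\rangle\oplus\mathbf V$. Then the global Poisson–Lie bracket on $\tilde G$ with cocycle $\delta$ is given, in the coordinate functions $h^1,v^i$, by $$\{h^1,v^j\}=0\ \ \forall j,\qquad \{v^i,v^j\}=\Omega^{ij}(h^1)+C^{ij}_kv^k,$$ where the matrix $\Omega(h^1)=(\Omega^{ij}(h^1))$ is $$\Omega(h^1)=\exp(-h^1\beta)\left(\int_0^{h^1}\exp\big(s(\alpha+\beta)\big)\,\Omega_0\,\big(\exp(s(\alpha+\beta))\big)^{t}\,ds\right)\big(\exp(-h^1\beta)\big)^{t},$$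 with ${}^t$ denoting matrix transposition.
   Context: Summation over repeated indices is assumed. $\alpha^*,\beta^*$ are the dual (transpose) maps on $\mathbf V^*$. The coordinate functions on $\tilde G$ are $h^1$ (with $h^1(th_1,\xi)=t$) and the elements $v^i\in\mathbf V=(\mathbf V^* )^*$ viewed as linear functions on $\mathbf V^*$. In these coordinates the group law gives the coproduct $\Delta(h^1)=h^1\otimes1+1\otimes h^1$, $\Delta(v^i)=e^{h^1\otimes\alpha}(1\otimes v^i)+e^{-\beta\otimes h^1}(v^i\otimes1)$, where $e^{h^1\otimes\alpha}(1\otimes v^i)=\sum_{n\ge0}\frac{(h^1)^n}{n!}\otimes\alpha^n(v^i)$ and $e^{-\beta\otimes h^1}(v^i\otimes1)=\sum_{n\ge0}\frac{(-1)^n}{n!}\beta^n(v^i)\otimes(h^1)^n$. Since $\tilde G$ is simply connected, a Poisson–Lie structure with a given Lie bialgebra cocycle exists and is unique. *)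

(* Defs.v *)
From HB Require Import structures.
From mathcomp Require Import all_boot all_order all_algebra.
From mathcomp Require Import all_classical all_reals all_analysis.
Set Implicit Arguments. Unset Strict Implicit. Unset Printing Implicit Defensive.
Import Order.TTheory GRing.Theory Num.Theory.
Import numFieldNormedType.Exports.
Local Open Scope classical_set_scope.
Local Open Scope ring_scope.

Section Defs.
Variable R : realType.

Definition expm (n : nat) (A : 'M[R]_n) : 'M[R]_n :=
  \matrix_(i, j) limn [series ((A ^+ k) i j / (k`!)%:R)]_k.

Definition oint (f : R -> R) (t : R) : R :=
  if 0 <= t then \int[lebesgue_measure]_(s in `[0, t]) f s
  else - \int[lebesgue_measure]_(s in `[t, 0]) f s.

(* Coordinates on G~ = <h_1> (+) V^* ~ R^(1+n):
   index ord0 <-> coordinate h^1, index (lift ord0 i) <-> coordinate v^i.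
   A point is a row vector x with x 0 ord0 = t and x 0 (lift ord0 i) = xi_i = v^i(xi). *)
Definition hc (n : nat) (x : 'rV[R]_(n.+1)) : R := x 0 ord0.
Definition vc (n : nat) (x : 'rV[R]_(n.+1)) (i : 'I_n) : R := x 0 (lift ord0 i).

(* Group law (t h_1, xi) * (t' h_1, xi') = ((t+t') h_1, e^{t alpha^*} xi' + e^{-t' beta^*} xi),
   with (alpha^* xi)(v^i) = xi(alpha v^i) = alpha^i_j xi_j. *)
Definition gmul (n : nat) (al be : 'M[R]_n) (x y : 'rV[R]_(n.+1)) : 'rV[R]_(n.+1) :=
  \row_a match unlift ord0 a with
         | None => hc x + hc y
         | Some i => \sum_j expm (hc x *: al) i j * vc y j
                     + \sum_j expm (- hc y *: be) i j * vc x j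
         end.

Definition partial (N : nat) (F : 'rV[R]_N -> R) (c : 'I_N) (x : 'rV[R]_N) : R :=
  derive F x (delta_mx 0 c).

Definition Omega (n : nat) (al be Om0 : 'M[R]_n) (t : R) : 'M[R]_n :=
  expm (- t *: be) *m
  (\matrix_(i, j) oint (fun s => (expm (s *: (al + be)) *m Om0 *m
                                   (expm (s *: (al + be)))^T) i j) t)
  *m (expm (- t *: be))^T.

(* The claimed Poisson bivector: pi^{ab}(x) = {x^a, x^b}(x), with
   {h^1, .} = 0 and {v^i, v^j} = Omega^{ij}(h^1) + C^{ij}_k v^k. *)
Definition PLbivector (n : nat) (C : 'I_n -> 'I_n -> 'I_n -> R) (al be Om0 : 'M[R]_n)
  (x : 'rV[R]_(n.+1)) : 'M[R]_(n.+1) :=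
  \matrix_(a, b) match unlift ord0 a, unlift ord0 b with
                 | Some i, Some j => Omega al be Om0 (hc x) i j + \sum_k C i j k * vc x k
                 | _, _ => 0
                 end.

(* Structure constants [e_a, e_b] = f a b c e_c of the Lie algebra g = <h_1> (+) V^*
   of G~ (obtained from the group law): [h_1, xi] = (alpha+beta)^* xi, [xi, xi'] = 0,
   in the basis (h_1, dual basis of (v^i)). *)
Definition gconst (n : nat) (al be : 'M[R]_n) (a b c : 'I_n.+1) : R :=
  match unlift ord0 a, unlift ord0 b, unlift ord0 c with
  | None, Some i, Some k => (al + be) k i
  | Some i, None, Some k => - (al + be) k i
  | _, _, _ => 0
  end.

Definition Econst (n : nat) (C : 'I_n -> 'I_n -> 'I_n -> R) (Om0 : 'M[R]_n)
  (a b c : 'I_n.+1) : R :=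
  match unlift ord0 a, unlift ord0 b, unlift ord0 c with
  | Some i, Some j, None => Om0 i j
  | Some i, Some j, Some k => C i j k
  | _, _, _ => 0
  end.

(* delta : g -> g /\ g with delta(e_d)^{ab} = F a b d is a 1-cocycle for the adjoint action:
   delta [e_d, e_e] = ad_{e_d} delta(e_e) - ad_{e_e} delta(e_d). *)
Definition bialgebra_cocycle (N : nat) (f F : 'I_N -> 'I_N -> 'I_N -> R) : Prop :=
  forall a b d e : 'I_N,
    \sum_c f d e c * F a b c =
      \sum_c (f d c a * F c b e + f d c b * F a c e)
    - \sum_c (f e c a * F c b d + f e c b * F a c d).

End Defs.

(* Main.v *)
(* With E_D(t) = exp(tD), everything is an identity of matrix-valued functions of one real
   variable, proved by differentiating and comparing values at 0.
   - exp(tD) is an automorphism of V for a derivation D, and pulling back along an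
     automorphism preserves 2-cocycles; so the integrand, its integral J and
     Omega(t) = E_beta(-t) J(t) E_beta(-t)^T are 2-cocycles of V, and the Jacobi identity
     of the bracket is this cocycle identity plus the Jacobi identity of V.
   - Since J(s + t) = J(s) + E_{alpha+beta}(s) J(t) E_{alpha+beta}(s)^T and alpha, beta commute,
     Omega(s + t) = E_beta(-t) Omega(s) E_beta(-t)^T + E_alpha(s) Omega(t) E_alpha(s)^T; with the
     automorphism property on the linear part, this is multiplicativity. *)
Require Import Defs.
From HB Require Import structures.
From mathcomp Require Import all_boot all_order all_algebra.
From mathcomp Require Import all_classical all_reals all_analysis.
From mathcomp Require Import ring.
Set Implicit Arguments. Unset Strict Implicit. Unset Printing Implicit Defensive.
Import Order.TTheory GRing.Theory Num.Theory.
Import numFieldNormedType.Exports.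
Local Open Scope ring_scope.

(** * Entrywise calculus of matrix-valued functions of one real variable *)

Section MatrixDerivative.
Context {R : realType}.

(** Taken entry by entry, so that only scalar calculus is involved and no norm on matrices has to be
    chosen. *)
Definition mxderive m n (F : R -> 'M[R]_(m, n)) (t : R) (D : 'M[R]_(m, n)) : Prop :=
  forall i j, is_derive t (1 : R) (fun s => F s i j) (D i j).

Lemma mxderive_cst m n (A : 'M[R]_(m, n)) t : mxderive (fun=> A) t 0.
Proof. by move=> i j; rewrite mxE; exact: is_derive_cst. Qed.

Lemma mxderive_add m n (F G : R -> 'M[R]_(m, n)) t DF DG :
  mxderive F t DF -> mxderive G t DG -> mxderive (fun s => F s + G s) t (DF + DG).
Proof.
move=> dF dG i j; rewrite mxE.
under eq_fun do rewrite mxE.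
exact: (is_deriveD (f := fun s => F s i j) (g := fun s => G s i j)).
Qed.

Lemma mxderive_mul m n p (F : R -> 'M[R]_(m, n)) (G : R -> 'M[R]_(n, p)) t DF DG :
  mxderive F t DF -> mxderive G t DG ->
  mxderive (fun s => F s *m G s) t (DF *m G t + F t *m DG).
Proof.
move=> dF dG i j.
pose h k s := F s i k * G s k j.
have dh k : is_derive t (1 : R) (h k) (DF i k * G t k j + F t i k * DG k j).
  have := is_deriveM (dF i k) (dG k j).
  by move/is_derive_eq; apply; rewrite addrC /GRing.scale /= (mulrC (G t k j)).
have -> : (fun s => (F s *m G s) i j) = \sum_k h k.
  by apply/funext => s; rewrite mxE fct_sumE.
by apply: is_derive_eq (is_derive_sum dh) _; rewrite !mxE -big_split.
Qed.

Lemma mxderive_tr m n (F : R -> 'M[R]_(m, n)) t D :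
  mxderive F t D -> mxderive (fun s => (F s)^T) t D^T.
Proof. by move=> dF i j; rewrite mxE; under eq_fun do rewrite mxE; exact: dF. Qed.

Lemma mxderive_eq {m n} {F : R -> 'M[R]_(m, n)} {t D} D' :
  mxderive F t D -> D = D' -> mxderive F t D'.
Proof. by move=> ? <-. Qed.

Lemma mxderive_comp m n (F : R -> 'M[R]_(m, n)) g t D g' :
  mxderive F (g t) D -> is_derive t (1 : R) g g' ->
  mxderive (fun s => F (g s)) t (g' *: D).
Proof.
move=> dF dg i j; rewrite mxE mulrC.
exact: (is_derive1_comp (f := fun s => F s i j)).
Qed.

Lemma mxderive_0_is_cst m n (F : R -> 'M[R]_(m, n)) s t :
  (forall u, mxderive F u 0) -> F s = F t.
Proof.
move=> dF; apply/matrixP => i j.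
apply: (is_derive_0_is_cst (f := fun s => F s i j)) => u.
by have := dF u i j; rewrite mxE.
Qed.

Lemma mxderive_unique m n (F G : R -> 'M[R]_(m, n)) D t0 :
  (forall u, mxderive F u (D u)) -> (forall u, mxderive G u (D u)) -> F t0 = G t0 ->
  F =1 G.
Proof.
move=> dF dG e t; apply/eqP; rewrite -subr_eq0; apply/eqP.
rewrite (@mxderive_0_is_cst _ _ (fun s => F s - G s) t t0) ?e ?subrr// => u i j.
rewrite mxE -(subrr (D u i j)).
under eq_fun do rewrite !mxE.
exact: (is_deriveB (dF u i j) (dG u i j)).
Qed.

End MatrixDerivative.

(** * The exponential series of a matrix and its derivative *)

Section MatrixExponential.
Context {R : realType} {n : nat}.
Implicit Types A B : 'M[R]_n.

Definition mx_absum A : R := \sum_i \sum_j `|A i j|.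

(** [mx_absum A] dominates the absolute sum of each row, so each further factor [A] costs at most
    one factor [mx_absum A]. *)
Lemma expr_mx_bound A k i j : `|(A ^+ k) i j| <= mx_absum A ^+ k.
Proof.
elim: k i j => [|k IH] i j.
  by rewrite !expr0 mxE; case: (_ == _); rewrite ?normr1 ?normr0.
rewrite !exprS mxE (le_trans (ler_norm_sum _ _ _))//.
rewrite (@le_trans _ _ (\sum_l `|A i l| * mx_absum A ^+ k))//.
  by apply: ler_sum => l _; rewrite normrM ler_wpM2l.
rewrite -mulr_suml ler_wpM2r ?exprn_ge0 ?sumr_ge0//.
  by move=> a _; rewrite sumr_ge0.
rewrite /mx_absum [leRHS](bigD1 i)//= lerDl sumr_ge0// => a _.
by rewrite sumr_ge0.
Qed.

(* Power series coefficients of the p-th derivative of exp(tA)_ij at t = 0. *)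
Definition ecoef A i j (p k : nat) : R := (A ^+ (p + k)%N) i j / k`!%:R.

(** Absolute convergence, by comparison with a constant multiple of the scalar exponential series at
    [mx_absum A * |x|]. *)
Lemma is_cvg_ecoef A i j p x : cvgn (pseries (ecoef A i j p) x).
Proof.
have absum0 : 0 <= mx_absum A by rewrite sumr_ge0// => a _; rewrite sumr_ge0.
apply: normed_cvg.
apply: (@series_le_cvg _ _ (fun k => mx_absum A ^+ p * exp_coeff (mx_absum A * `|x|) k)).
- by move=> k /=.
- by move=> k; rewrite mulr_ge0 ?exprn_ge0// exp_coeff_ge0// mulr_ge0.
- move=> k /=; rewrite /exp_coeff /= /ecoef !normrM exprMn normfV (ger0_norm (ler0n _ _)).
  rewrite normrX mulrAC !mulrA -exprD.
  by rewrite !ler_wpM2r ?invr_ge0 ?exprn_ge0// expr_mx_bound.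
- apply: is_cvg_seriesZ; exact: is_cvg_series_exp_coeff.
Qed.

Lemma pseries_diffs_ecoef A i j p :
  pseries_diffs (ecoef A i j p) = ecoef A i j p.+1.
Proof.
apply/funext => k; rewrite /pseries_diffs /ecoef addnS addSn factS natrM.
rewrite invfM mulrCA; congr (_ * _); rewrite mulVKf//.
Qed.

Lemma expmE A t i j : expm (t *: A) i j = limn (pseries (ecoef A i j 0) t).
Proof.
rewrite mxE; congr (limn (series _)); apply/funext => k.
rewrite /= /ecoef add0n mulrAC; congr (_ / _).
elim: k i j => [|k IH] i j; first by rewrite !expr0 mulr1.
rewrite !exprS !mxE mulr_suml; apply: eq_bigr => l _.
by rewrite IH mxE (mulrCA _ t) !mulrA (mulrC t).
Qed.

Lemma mxderive_expm A t : mxderive (fun s => expm (s *: A)) t (A *m expm (t *: A)).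
Proof.
move=> i j; under eq_fun do rewrite expmE.
have -> : (A *m expm (t *: A)) i j = limn (pseries (pseries_diffs (ecoef A i j 0)) t).
  rewrite pseries_diffs_ecoef mxE; apply/esym/cvg_lim => //.
  (* At the level of partial sums the shifted series is a finite combination of unshifted ones, so
     the factor [A] can be pulled out before passing to the limit. *)
  have -> : pseries (ecoef A i j 1) t =
      (fun N => \sum_l A i l * pseries (ecoef A l j 0) t N).
    apply/funext => N; rewrite /pseries /series /=.
    under [RHS]eq_bigr do rewrite mulr_sumr.
    rewrite exchange_big; apply: eq_bigr => k _ /=.
    rewrite /ecoef add1n add0n exprS mxE !mulr_suml; apply: eq_bigr => l _.
    by rewrite !mulrA.
  apply: cvg_big => [|l _]; first exact: add_continuous.
  rewrite expmE.
  by apply: cvgM; [exact: cvg_cst | exact: is_cvg_ecoef].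
(* Termwise differentiation at [t] needs convergence at some point of larger modulus; [|t| + 1] is
   one. *)
apply: (@pseries_snd_diffs _ _ (`|t| + 1)); rewrite ?pseries_diffs_ecoef;
  try exact: is_cvg_ecoef.
by rewrite [ltRHS]ger0_norm ?addr_ge0// ltrDl.
Qed.

Lemma expm0 : expm (0 : 'M[R]_n) = 1%:M.
Proof.
apply/matrixP => i j; rewrite -(scale0r (0 : 'M[R]_n)) expmE.
apply: cvg_lim => //; apply/cvg_ballP => e e0; near=> N.
rewrite /pseries /series /=.
(* From [N = 1] on, the partial sum at 0 reduces to its constant term. *)
have -> : N = N.-1.+1 by rewrite prednK//; near: N; exists 1%N.
rewrite big_nat_recl// big1 => [|k _]; last by rewrite expr0n mulr0.
by rewrite addr0 /ecoef fact0 divr1 mulr1 expr0; exact: ballxx.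
Unshelve. all: by end_near. Qed.

End MatrixExponential.

(** * The fundamental theorem of calculus for the oriented integral *)

Section OrientedIntegral.
Context {R : realType} (f : R -> R).
Hypothesis cf : continuous f.
Local Notation mu := (@lebesgue_measure R).

Lemma continuous_integrable (a b : R) : mu.-integrable `[a, b]%classic (EFin \o f).
Proof.
apply: continuous_compact_integrable; first exact: segment_compact.
exact: continuous_subspaceT.
Qed.

(** Moving the base point from 0 down to [a] removes the sign distinction in [oint], which would
    otherwise obstruct differentiation at 0. *)
Lemma oint_sub (a x : R) : a <= 0 -> a <= x ->
  oint f x = \int[mu]_(s in `[a, x]) f s - \int[mu]_(s in `[a, 0]) f s.
Proof.
move=> a0 ax; rewrite /oint; case: leP => x0.
  rewrite (@Rintegral_itvB _ _ (BLeft a) (BRight x) 0) ?bnd_simp//.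
    rewrite Rintegral_itv_obnd_cbnd//.
    apply: integrableS (continuous_integrable 0 x) => //.
    exact: subset_itv_oc_cc.
  exact: continuous_integrable.
rewrite -[RHS]opprB; congr (- _).
rewrite (@Rintegral_itvB _ _ (BLeft a) (BRight 0) x) ?bnd_simp// ?ltW//.
  rewrite Rintegral_itv_obnd_cbnd//.
  apply: integrableS (continuous_integrable x 0) => //.
  exact: subset_itv_oc_cc.
exact: continuous_integrable.
Qed.

Lemma is_derive_oint t : is_derive t (1 : R) (oint f) (f t).
Proof.
(* A base point below both 0 and [t]. *)
pose a := - (`|t| + 1).
have a0 : a <= 0 by rewrite oppr_le0 addr_ge0.
have at_ : a < t by rewrite ltrNl (le_lt_trans (ler_norm _))// normrN ltrDl.
pose F x := \int[mu]_(s in `[a, x]) f s.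
have [dF F'] := @continuous_FTC1_closed _ f a t (t + 1) ltac:(by rewrite ltrDl)
  (continuous_integrable _ _) at_ (@cf t).
(* All points near [t] exceed [a], so there [oint f] differs from [F] only by a constant. *)
apply: (@near_eq_is_derive _ _ _ (F - cst (F 0))).
  near=> x; rewrite (@oint_sub a)//; apply: ltW; near: x.
  exact: lt_nbhsr.
rewrite -[f t]subr0; apply: is_deriveB.
by rewrite -F' derive1E; exact: DeriveDef.
Unshelve. all: by end_near. Qed.

End OrientedIntegral.

(** * Algebraic laws of the matrix exponential *)

Section ExpAlgebra.
Context {R : realType} {n : nat}.
Implicit Types A B : 'M[R]_n.

Lemma mxderive_expmN A t : mxderive (fun s => expm (- s *: A)) t (- A *m expm (- t *: A)).
Proof.
have -> : (fun s => expm (- s *: A)) = (fun s => expm (s *: - A)).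
  by apply/funext => s; rewrite scalerN scaleNr.
by rewrite scaleNr -scalerN; exact: mxderive_expm.
Qed.

Lemma expm_tr A : expm A^T = (expm A)^T.
Proof.
apply/matrixP => i j; rewrite !mxE; congr (limn (series _)); apply/funext => k /=.
congr (_ / _); elim: k i j => [|k IH] i j; first by rewrite !expr0 !mxE eq_sym.
by rewrite exprS exprSr !mxE; apply: eq_bigr => l _; rewrite IH mxE mulrC.
Qed.

(* The series of exp(tA^T) gives exp(tA)' = exp(tA) A by transposition, and derivatives
   are unique. *)
Lemma expm_commr A t : expm (t *: A) *m A = A *m expm (t *: A).
Proof.
have dT := mxderive_tr (mxderive_expm A^T t).
apply/matrixP => i j; have [_ <-] := mxderive_expm A t i j.
have [_ e] := dT i j; rewrite trmx_mul -linearZ expm_tr !trmxK in e.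
rewrite -e; congr ('D_1 _ t); apply/funext => s.
by rewrite -linearZ expm_tr trmxK.
Qed.

(** The derivative of the conjugate in [t] is zero because [A] commutes with its exponential and
    with [B]. Taking [B = 1] gives inverses; general [B] gives commutation with the exponential. *)
Lemma expm_conj A B t : A *m B = B *m A ->
  expm (- t *: A) *m B *m expm (t *: A) = B.
Proof.
move=> AB.
rewrite (@mxderive_0_is_cst _ _ _ (fun s => expm (- s *: A) *m B *m expm (s *: A)) t 0).
  by rewrite oppr0 scale0r expm0 mul1mx mulmx1.
move=> u; apply: mxderive_eq
  (mxderive_mul (mxderive_mul (mxderive_expmN A u) (mxderive_cst B u)) (mxderive_expm A u)) _.
rewrite mulmx0 addr0 !mulNmx -(expm_commr A (- u)) -!mulmxA (mulmxA A B) AB.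
by rewrite -!mulmxA addNr.
Qed.

Lemma expmNK A t : expm (- t *: A) *m expm (t *: A) = 1%:M.
Proof. by have := @expm_conj A 1%:M t; rewrite !mulmx1 mul1mx; apply. Qed.

Lemma expmK A t : expm (t *: A) *m expm (- t *: A) = 1%:M.
Proof. by rewrite -{1}(opprK t) expmNK. Qed.

Lemma expm_commute A B t : A *m B = B *m A ->
  B *m expm (t *: A) = expm (t *: A) *m B.
Proof. by move=> /(@expm_conj _ _ t) {2}<-; rewrite !mulmxA expmK mul1mx. Qed.

(** The integrating factor [expm (- t *: A)] turns [F] into a constant. Both addition laws for
    exponentials below follow from this uniqueness. *)
Lemma linear_ode A (X : 'M[R]_n) (F : R -> 'M[R]_n) : (forall t, mxderive F t (A *m F t)) ->
  F 0 = X -> forall t, F t = expm (t *: A) *m X.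
Proof.
move=> dF F0 t.
have e : expm (- t *: A) *m F t = X.
  rewrite (@mxderive_0_is_cst _ _ _ (fun s => expm (- s *: A) *m F s) t 0).
    by rewrite oppr0 scale0r expm0 mul1mx.
  move=> u; apply: mxderive_eq (mxderive_mul (mxderive_expmN A u) (dF u)) _.
  by rewrite !mulNmx -expm_commr mulmxA addNr.
by rewrite -e mulmxA expmK mul1mx.
Qed.

Lemma expm_scaleD A s t : expm ((s + t) *: A) = expm (s *: A) *m expm (t *: A).
Proof.
apply: (@linear_ode _ _ (fun s => expm ((s + t) *: A))) => [u|]; last by rewrite add0r.
have du : is_derive u (1 : R) (fun v => v + t) 1.
  by rewrite -[X in is_derive _ _ _ X]addr0; exact: (is_deriveD (f := id) (g := cst t)).
apply: mxderive_eq
  (@mxderive_comp _ _ _ (fun v => expm (v *: A)) (fun v => v + t) u _ 1 _ du) _.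
  exact: mxderive_expm.
by rewrite scale1r.
Qed.

Lemma expm_addmx A B t : A *m B = B *m A ->
  expm (t *: (A + B)) = expm (t *: A) *m expm (t *: B).
Proof.
move=> AB; apply/esym.
rewrite (@linear_ode (A + B) 1%:M (fun t => expm (t *: A) *m expm (t *: B))) ?mulmx1//.
  move=> u; apply: mxderive_eq (mxderive_mul (mxderive_expm A u) (mxderive_expm B u)) _.
  by rewrite mulmxDl !mulmxA (expm_commute _ AB).
by rewrite !scale0r !expm0 mulmx1.
Qed.

End ExpAlgebra.

(** * Derivations, automorphisms and 2-cocycles of V in coordinates *)

Section LieCocycles.
Context {R : realType} {n : nat} (C : 'I_n -> 'I_n -> 'I_n -> R).
Implicit Types (D E W : 'M[R]_n) (w : 'cV[R]_n).

(** The linear (Lie-Poisson) bivector of V at the point [w] of the dual space. *)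
Definition bracket_mx w : 'M[R]_n := \matrix_(i, j) \sum_k C i j k * w k 0.

Definition lie_derivation D := forall i j l,
  \sum_k C i j k * D k l = \sum_p (D i p * C p j l + D j p * C i p l).

(** [E] respects the bracket of V, stated dually: its transpose map, which sends a point [w] to
    [E *m w], is a Poisson map for the linear bivector. *)
Definition lie_morphism E := forall w, bracket_mx (E *m w) = E *m bracket_mx w *m E^T.

Definition cocycle2 W := forall i j l,
  \sum_k (C i j k * W k l + C j l k * W k i + C l i k * W k j) = 0.

Lemma bracket_mx_add w w' : bracket_mx (w + w') = bracket_mx w + bracket_mx w'.
Proof.
apply/matrixP => i j; rewrite !mxE -big_split; apply: eq_bigr => k _.
by rewrite mxE mulrDr.
Qed.

(** The infinitesimal form of [lie_morphism]. *)
Lemma bracket_mx_derivation D w : lie_derivation D ->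
  bracket_mx (D *m w) = D *m bracket_mx w + bracket_mx w *m D^T.
Proof.
move=> Dder; apply/matrixP => i j; rewrite !mxE.
transitivity (\sum_l (\sum_k C i j k * D k l) * w l 0).
  under eq_bigr do rewrite mxE mulr_sumr.
  rewrite exchange_big; apply: eq_bigr => l _; rewrite mulr_suml.
  by apply: eq_bigr => k _; rewrite mulrA.
under eq_bigr do rewrite Dder mulr_suml.
rewrite exchange_big -big_split; apply: eq_bigr => p _ /=.
rewrite !mxE mulr_sumr mulr_suml -big_split; apply: eq_bigr => l _ /=.
ring.
Qed.

Lemma mxderive_bracket_mx (F : R -> 'cV[R]_n) t DF :
  mxderive F t DF -> mxderive (fun s => bracket_mx (F s)) t (bracket_mx DF).
Proof.
move=> dF i j; rewrite mxE; under eq_fun do rewrite mxE.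
rewrite (_ : (fun s => _) = \sum_k (fun s => C i j k * F s k 0)); last first.
  by apply/funext => s; rewrite fct_sumE.
by apply: is_derive_sum => k; exact: is_deriveZ.
Qed.

Lemma lie_morphism_expm D t : lie_derivation D -> lie_morphism (expm (t *: D)).
Proof.
move=> Dder w.
suff e : expm (- t *: D) *m bracket_mx (expm (t *: D) *m w) *m (expm (- t *: D))^T = bracket_mx w.
  by rewrite -e !mulmxA expmK mul1mx -mulmxA -trmx_mul expmK trmx1 mulmx1.
(* Undoing the flow of [D] gives a constant function: the two terms from the derivation rule cancel
   those from the outer exponentials. *)
pose F s := expm (- s *: D) *m bracket_mx (expm (s *: D) *m w) *m (expm (- s *: D))^T.
rewrite -[LHS]/(F t) (@mxderive_0_is_cst _ _ _ F t 0); last first.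
  move=> u; have dE := mxderive_expmN D u.
  have dM := mxderive_bracket_mx (mxderive_mul (mxderive_expm D u) (mxderive_cst w u)).
  apply: mxderive_eq (mxderive_mul (mxderive_mul dE dM) (mxderive_tr dE)) _.
  rewrite mulmx0 addr0 -[D *m _ *m w]mulmxA (bracket_mx_derivation _ Dder).
  rewrite !mulNmx -(expm_commr D (- u)) linearN /= trmx_mul.
  rewrite !(mulmxN, mulNmx, mulmxDr, mulmxDl, mulmxA).
  by rewrite addKr subrr.
by rewrite /F oppr0 scale0r expm0 mul1mx mul1mx trmx1 mulmx1.
Qed.

Lemma cocycle2_pullback E W : lie_morphism E -> cocycle2 W -> cocycle2 (E *m W *m E^T).
Proof.
move=> hE hW i j l.
(* [S p q r] is W([v^p, v^q], v^r); the claim is trilinear in three rows of [E], with these values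
   as coefficients. *)
pose S p q r := \sum_k C p q k * W k r.
have key a b c : \sum_k C a b k * (E *m W *m E^T) k c =
    \sum_p \sum_q \sum_r E a p * E b q * E c r * S p q r.
  (* Fixing the last argument of the pulled-back form leaves a linear form on V, that is a point of
     the dual, to which the morphism property applies. *)
  transitivity (bracket_mx (E *m (W *m (row c E)^T)) a b).
    rewrite mxE; apply: eq_bigr => k _; rewrite -mulmxA !mxE; congr (_ * _).
    apply: eq_bigr => p _; congr (_ * _); rewrite !mxE; apply: eq_bigr => r _.
    by rewrite !mxE.
  rewrite hE mxE.
  under eq_bigr do rewrite mxE mulr_suml.
  rewrite exchange_big; apply: eq_bigr => p _; apply: eq_bigr => q _.
  rewrite !mxE.
  under eq_bigr do rewrite mxE mulr_sumr.
  rewrite exchange_big mulr_sumr mulr_suml; apply: eq_bigr => r _.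
  rewrite /S !mulr_sumr mulr_suml; apply: eq_bigr => k _.
  rewrite !mxE; ring.
rewrite !big_split /= !key.
(* Renaming summation indices gives all three cyclic sums the common factor [E i p * E j q * E l r],
   so that the cocycle identity of [W] applies termwise. *)
rewrite [X in _ + X + _](_ : _ =
    \sum_p \sum_q \sum_r E i p * E j q * E l r * S q r p); last first.
  under eq_bigr do rewrite exchange_big.
  rewrite exchange_big; apply: eq_bigr => p _; apply: eq_bigr => q _.
  by apply: eq_bigr => r _; ring.
rewrite [X in _ + X](_ : _ =
    \sum_p \sum_q \sum_r E i p * E j q * E l r * S r p q); last first.
  rewrite exchange_big; apply: eq_bigr => p _; rewrite exchange_big.
  apply: eq_bigr => q _; apply: eq_bigr => r _; ring.
rewrite -!big_split /= big1// => p _; rewrite -!big_split /= big1// => q _.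
rewrite -!big_split /= big1// => r _; rewrite -!mulrDr /S -!big_split /=.
by rewrite hW mulr0.
Qed.

(** The cocycle condition is linear with constant coefficients, so its left side has zero derivative
    and vanishes at 0. *)
Lemma mxderive_cocycle2 (F DF : R -> 'M[R]_n) : (forall t, mxderive F t (DF t)) ->
  F 0 = 0 -> (forall t, cocycle2 (DF t)) -> forall t, cocycle2 (F t).
Proof.
move=> dF F0 hDF t i j l.
pose z k s := C i j k * F s k l + C j l k * F s k i + C l i k * F s k j.
suff dz u : is_derive u (1 : R) (\sum_k z k) 0.
  transitivity ((\sum_k z k) t); first by rewrite fct_sumE.
  rewrite (is_derive_0_is_cst t 0 dz) fct_sumE big1// => k _.
  by rewrite /z F0 !mxE !mulr0 !addr0.
rewrite -(hDF u i j l); apply: is_derive_sum => k.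
apply: (@is_deriveD _ _ _ (fun s => C i j k * F s k l + C j l k * F s k i)
  (fun s => C l i k * F s k j)); last exact: (is_deriveZ _ (dF u k j)).
apply: (@is_deriveD _ _ _ (fun s => C i j k * F s k l) (fun s => C j l k * F s k i));
  [exact: (is_deriveZ _ (dF u k l)) | exact: (is_deriveZ _ (dF u k i))].
Qed.

End LieCocycles.

(** * The integral J inside Omega, for a general generator [A] *)

Section OmegaIntegral.
Context {R : realType} {n : nat} (A Om0 : 'M[R]_n).

Definition conj_expm_int (t : R) : 'M[R]_n :=
  \matrix_(i, j) oint (fun s => (expm (s *: A) *m Om0 *m (expm (s *: A))^T) i j) t.

Let f s := expm (s *: A) *m Om0 *m (expm (s *: A))^T.

Lemma mxderive_int t : mxderive conj_expm_int t (f t).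
Proof.
move=> i j; under eq_fun do rewrite mxE.
apply: (@is_derive_oint _ (fun s => f s i j)) => s.
have dE := mxderive_expm A s.
have [df _] := mxderive_mul (mxderive_mul dE (mxderive_cst Om0 s)) (mxderive_tr dE) i j.
exact/differentiable_continuous/derivable1_diffP.
Qed.

Lemma conj_expm_int0 : conj_expm_int 0 = 0.
Proof.
apply/matrixP => i j; rewrite !mxE /oint lexx set_itv1.
exact: Rintegral_set1.
Qed.

Lemma conj_expm_int_tr t : Om0^T = - Om0 -> (conj_expm_int t)^T = - conj_expm_int t.
Proof.
move=> h; apply/eqP; rewrite -addr_eq0; apply/eqP.
rewrite (@mxderive_0_is_cst _ _ _ (fun s => (conj_expm_int s)^T + conj_expm_int s) t 0).
  by rewrite conj_expm_int0 trmx0 addr0.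
move=> u; apply: mxderive_eq (mxderive_add (mxderive_tr (mxderive_int u)) (mxderive_int u)) _.
by rewrite /f !trmx_mul trmxK h mulNmx mulmxN mulmxA addNr.
Qed.

(** As functions of [t] both sides have derivative [f (s + t)], because conjugating [f t] by
    [expm (s *: A)] shifts its argument, and they agree at [t = 0]. *)
Lemma conj_expm_int_add s t :
  conj_expm_int (s + t) = conj_expm_int s + expm (s *: A) *m conj_expm_int t *m (expm (s *: A))^T.
Proof.
pose F t := conj_expm_int (s + t).
pose G t := conj_expm_int s + expm (s *: A) *m conj_expm_int t *m (expm (s *: A))^T.
rewrite -[LHS]/(F t) -[RHS]/(G t).
apply: (@mxderive_unique _ _ _ F G (fun u => f (s + u)) 0) => [u|u|].
- have du : is_derive u (1 : R) (fun v => s + v) 1.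
    by rewrite -[X in is_derive _ _ _ X]add0r; exact: (is_deriveD (f := cst s) (g := id)).
  apply: mxderive_eq
    (@mxderive_comp _ _ _ conj_expm_int (fun v => s + v) u _ 1 (mxderive_int _) du) _.
  by rewrite scale1r.
- have dE := mxderive_cst (expm (s *: A)) u.
  apply: mxderive_eq (mxderive_add (mxderive_cst (conj_expm_int s) u)
    (mxderive_mul (mxderive_mul dE (mxderive_int u)) (mxderive_tr dE))) _.
  rewrite trmx0 mulmx0 mul0mx !add0r addr0 /f expm_scaleD trmx_mul.
  by rewrite !mulmxA.
- by rewrite /F /G conj_expm_int0 mulmx0 mul0mx !addr0.
Qed.

End OmegaIntegral.

(** * Derivative, antisymmetry, addition law and cocycle property of Omega *)

Section Omega.
Context {R : realType} {n : nat} (al be Om0 : 'M[R]_n).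

Lemma OmegaE t : Omega al be Om0 t =
  expm (- t *: be) *m conj_expm_int (al + be) Om0 t *m (expm (- t *: be))^T.
Proof. by []. Qed.

Lemma mxderive_Omega t : exists D, mxderive (Omega al be Om0) t D.
Proof.
have dE := mxderive_expmN be t.
by eexists; exact: mxderive_mul (mxderive_mul dE (mxderive_int (al + be) Om0 t)) (mxderive_tr dE).
Qed.

(** At 0 the integral vanishes, which kills the terms where an outer exponential is differentiated;
    only the integrand at 0 survives. *)
Lemma mxderive_Omega0 : mxderive (Omega al be Om0) 0 Om0.
Proof.
have dE := mxderive_expmN be 0.
apply: mxderive_eq
  (mxderive_mul (mxderive_mul dE (mxderive_int (al + be) Om0 0)) (mxderive_tr dE)) _.
rewrite conj_expm_int0 oppr0 !scale0r expm0 !mulmx0 mul0mx add0r addr0.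
by rewrite trmx1 !mulmx1 !mul1mx.
Qed.

Lemma Omega_tr t : Om0^T = - Om0 -> (Omega al be Om0 t)^T = - Omega al be Om0 t.
Proof.
by move=> h; rewrite OmegaE !trmx_mul trmxK conj_expm_int_tr// mulNmx mulmxN mulmxA.
Qed.

Lemma Omega_add s t : al *m be = be *m al ->
  Omega al be Om0 (s + t) =
    expm (- t *: be) *m Omega al be Om0 s *m (expm (- t *: be))^T +
    expm (s *: al) *m Omega al be Om0 t *m (expm (s *: al))^T.
Proof.
move=> ab; rewrite !OmegaE conj_expm_int_add.
have eD : expm (- (s + t) *: be) = expm (- t *: be) *m expm (- s *: be).
  by rewrite addrC opprD expm_scaleD.
rewrite mulmxDr mulmxDl; congr (_ + _).
  by rewrite eD trmx_mul !mulmxA.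
(* This is where [al] and [be] must commute: the [s]-parts of the [be] exponentials cancel. *)
have e : expm (- (s + t) *: be) *m expm (s *: (al + be)) = expm (s *: al) *m expm (- t *: be).
  rewrite eD addrC expm_addmx// -!mulmxA (mulmxA (expm (- s *: be))) expmNK mul1mx.
  by do 2! apply: expm_commute.
by rewrite !mulmxA e -!mulmxA -!trmx_mul e.
Qed.

Lemma Omega_cocycle2 (C : 'I_n -> 'I_n -> 'I_n -> R) t :
  lie_derivation C al -> lie_derivation C be -> cocycle2 C Om0 ->
  cocycle2 C (Omega al be Om0 t).
Proof.
move=> hal hbe hOm0; rewrite OmegaE.
apply: cocycle2_pullback; first exact: lie_morphism_expm.
apply: (mxderive_cocycle2 (mxderive_int _ _)) => [|u]; first exact: conj_expm_int0.
apply: cocycle2_pullback => //; apply: lie_morphism_expm => i j l.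
(* It remains that [al + be] is a derivation. *)
under eq_bigr do rewrite mxE mulrDr.
rewrite big_split /= hal hbe -big_split; apply: eq_bigr => p _ /=.
rewrite !mxE; ring.
Qed.

End Omega.

(** * Partial derivatives as derivatives along coordinate lines *)

Section Partial.
Context {R : realType}.

Lemma partial_eq N (F : 'rV[R]_N -> R) c x d :
  is_derive (0 : R) (1 : R) (fun h => F (h *: delta_mx 0 c + x)) d -> partial F c x = d.
Proof.
case=> _ <-; rewrite /partial /derive;
  set g1 := fun h => h^-1 *: _; set g2 := fun h => h^-1 *: _.
suff -> : g1 = g2 by [].
by apply/funext => h; rewrite /g1 /g2 /= addr0 scale0r add0r [_%:A]mulr1.
Qed.

Lemma hc_line n (h : R) c (x : 'rV[R]_n.+1) :
  hc (h *: delta_mx 0 c + x) = h * (ord0 == c)%:R + hc x.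
Proof. by rewrite /hc !mxE eqxx. Qed.

Lemma vc_line n (h : R) c (x : 'rV[R]_n.+1) i :
  vc (h *: delta_mx 0 c + x) i = h * (lift ord0 i == c)%:R + vc x i.
Proof. by rewrite /vc !mxE eqxx. Qed.

Lemma is_derive_affine (a b : R) : is_derive (0 : R) (1 : R) (fun h => h * a + b) a.
Proof.
have dm := is_deriveM (is_derive_id (0 : R) (1 : R)) (is_derive_cst a (0 : R) (1 : R)).
have /is_derive_eq := is_deriveD dm (is_derive_cst b (0 : R) (1 : R)).
by apply; rewrite /GRing.scale /= mul0r add0r mulr1 addr0.
Qed.

End Partial.

(** * Components and partial derivatives of the bivector and the group law *)

Section Bivector.
Context {R : realType} {n : nat} (C : 'I_n -> 'I_n -> 'I_n -> R) (al be Om0 : 'M[R]_n).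
Local Notation pi := (PLbivector C al be Om0).
Implicit Types x y : 'rV[R]_n.+1.

Definition vcol x : 'cV[R]_n := \col_i vc x i.

Lemma PLbivector0l x b : pi x ord0 b = 0.
Proof. by rewrite mxE unlift_none. Qed.

Lemma PLbivector0r x a : pi x a ord0 = 0.
Proof. by rewrite mxE unlift_none; case: unlift. Qed.

Lemma PLbivector_lift x i j : pi x (lift ord0 i) (lift ord0 j) =
  (Omega al be Om0 (hc x) + bracket_mx C (vcol x)) i j.
Proof.
rewrite mxE !liftK [RHS]mxE; congr (_ + _); rewrite mxE.
by apply: eq_bigr => k _; rewrite mxE.
Qed.

Lemma differentiable_PLbivector a b x : differentiable (fun y => pi y a b) x.
Proof.
case: (unliftP ord0 a) => [i ->|->]; last first.
  by under eq_fun do rewrite PLbivector0l; exact: differentiable_cst.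
case: (unliftP ord0 b) => [j ->|->]; last first.
  by under eq_fun do rewrite PLbivector0r; exact: differentiable_cst.
have -> : (fun y => pi y (lift ord0 i) (lift ord0 j)) =
    (fun y => Omega al be Om0 (hc y) i j) + \sum_k (fun y => C i j k * vc y k).
  by apply/funext => y; rewrite mxE !liftK fct_sumE.
apply: differentiableD.
  apply: (@differentiable_comp _ _ _ _ (@hc R n) (fun t => Omega al be Om0 t i j)).
    exact: differentiable_coord.
  have [D /(_ i j)[dO _]] := mxderive_Omega al be Om0 (hc x).
  exact/derivable1_diffP.
apply: differentiable_sum => k; apply: differentiableZ; exact: differentiable_coord.
Qed.

Lemma partial_PLbivector0l b c x : partial (fun y => pi y ord0 b) c x = 0.
Proof. by apply: partial_eq; under eq_fun do rewrite PLbivector0l; exact: is_derive_cst. Qed.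

Lemma partial_PLbivector0r a c x : partial (fun y => pi y a ord0) c x = 0.
Proof. by apply: partial_eq; under eq_fun do rewrite PLbivector0r; exact: is_derive_cst. Qed.

(** Along a v^k line h^1 is fixed, so Omega is constant and the component is affine. *)
Lemma partial_PLbivector_lift i j k x :
  partial (fun y => pi y (lift ord0 i) (lift ord0 j)) (lift ord0 k) x = C i j k.
Proof.
apply: partial_eq.
rewrite (_ : (fun h => _) = (fun h => h * C i j k + pi x (lift ord0 i) (lift ord0 j))).
  exact: is_derive_affine.
apply/funext => h; rewrite !PLbivector_lift !mxE hc_line mulr0 add0r addrCA; congr (_ + _).
rewrite (bigD1 k)//= [in RHS](bigD1 k)//= addrA; congr (_ + _).
  by rewrite !mxE vc_line eqxx mulr1; ring.
apply: eq_bigr => l lk; rewrite !mxE vc_line (inj_eq lift_inj) (negbTE lk).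
by rewrite mulr0 add0r.
Qed.

(** Along the h^1 axis through the identity the linear part is zero, which leaves the derivative of
    Omega at 0. *)
Lemma partial_PLbivector_h i j :
  partial (fun y => pi y (lift ord0 i) (lift ord0 j)) ord0 0 = Om0 i j.
Proof.
apply: partial_eq.
rewrite (_ : (fun h => _) = (fun h => Omega al be Om0 h i j)).
  exact: mxderive_Omega0.
apply/funext => h; rewrite PLbivector_lift hc_line eqxx mulr1 addr0.
rewrite (_ : hc 0 = 0) ?addr0; last by rewrite /hc mxE.
rewrite [LHS]mxE (_ : bracket_mx _ _ i j = 0) ?addr0// mxE big1// => k _.
by rewrite mxE /vc !mxE mulr0 mulr0.
Qed.

Lemma gmul_h x y : hc (gmul al be x y) = hc x + hc y.
Proof. by rewrite /hc mxE unlift_none. Qed.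

Lemma gmul_v x y : vcol (gmul al be x y) =
  expm (hc x *: al) *m vcol y + expm (- hc y *: be) *m vcol x.
Proof.
apply/colP => i; rewrite mxE /vc mxE liftK [RHS]mxE.
by congr (_ + _); rewrite [RHS]mxE; apply: eq_bigr => j _; rewrite [X in _ = _ * X]mxE.
Qed.

(** Only v-directions are needed for the group law: the h^1 row and column of the bivector vanish,
    so the h^1 direction drops out of the multiplicativity sums. *)
Lemma partial_gmul_h_l k x y :
  partial (fun z => gmul al be z y 0 ord0) (lift ord0 k) x = 0.
Proof.
apply: partial_eq.
rewrite (_ : (fun h => _) = cst (hc x + hc y)); first exact: is_derive_cst.
by apply/funext => h; rewrite -[LHS]/(hc _) gmul_h hc_line mulr0 add0r.
Qed.

Lemma partial_gmul_h_r k x y :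
  partial (fun z => gmul al be x z 0 ord0) (lift ord0 k) y = 0.
Proof.
apply: partial_eq.
rewrite (_ : (fun h => _) = cst (hc x + hc y)); first exact: is_derive_cst.
by apply/funext => h; rewrite -[LHS]/(hc _) gmul_h hc_line mulr0 add0r.
Qed.

Lemma vcol_line h k x :
  vcol (h *: delta_mx 0 (lift ord0 k) + x) = h *: delta_mx k 0 + vcol x.
Proof.
by apply/colP => i; rewrite !mxE vc_line (inj_eq lift_inj) eqxx andbT.
Qed.

Lemma partial_gmul_v_l i k x y :
  partial (fun z => gmul al be z y 0 (lift ord0 i)) (lift ord0 k) x =
  expm (- hc y *: be) i k.
Proof.
apply: partial_eq.
rewrite (_ : (fun h => _) =
  (fun h => h * expm (- hc y *: be) i k + vc (gmul al be x y) i)).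
  exact: is_derive_affine.
have vE z : gmul al be z y 0 (lift ord0 i) = vcol (gmul al be z y) i 0 by rewrite [RHS]mxE.
apply/funext => h; rewrite /vc !vE !gmul_v hc_line mulr0 add0r vcol_line.
by rewrite mulmxDr -scalemxAr -colE addrCA !mxE.
Qed.

Lemma partial_gmul_v_r i k x y :
  partial (fun z => gmul al be x z 0 (lift ord0 i)) (lift ord0 k) y =
  expm (hc x *: al) i k.
Proof.
apply: partial_eq.
rewrite (_ : (fun h => _) =
  (fun h => h * expm (hc x *: al) i k + vc (gmul al be x y) i)).
  exact: is_derive_affine.
have vE z : gmul al be x z 0 (lift ord0 i) = vcol (gmul al be x z) i 0 by rewrite [RHS]mxE.
apply/funext => h; rewrite /vc !vE !gmul_v hc_line mulr0 add0r vcol_line.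
by rewrite mulmxDr -scalemxAr -colE -addrA !mxE.
Qed.

End Bivector.

Theorem theorem1 (R : realType) (n : nat)
  (C : 'I_n -> 'I_n -> 'I_n -> R) (Om0 al be : 'M[R]_n)
  (* V is a Lie algebra: [v^i, v^j] = C^{ij}_k v^k *)
  (C_anti : forall i j k, C i j k = - C j i k)
  (C_jacobi : forall i j l m,
     \sum_k (C i j k * C k l m + C j l k * C k i m + C l i k * C k j m) = 0)
  (* Omega0 antisymmetric 2-cocycle of V *)
  (Om0_anti : forall i j, Om0 i j = - Om0 j i)
  (Om0_cocycle : forall i j l,
     \sum_k (C i j k * Om0 k l + C j l k * Om0 k i + C l i k * Om0 k j) = 0)
  (* alpha, beta derivations of V: alpha(v^i) = alpha^i_j v^j *)
  (al_der : forall i j l,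
     \sum_k C i j k * al k l = \sum_p (al i p * C p j l + al j p * C i p l))
  (be_der : forall i j l,
     \sum_k C i j k * be k l = \sum_p (be i p * C p j l + be j p * C i p l))
  (al_be_comm : al *m be = be *m al)
  (* delta (dual to the bracket (E)) is a Lie bialgebra cocycle on Lie(G~) *)
  (delta_cocycle : bialgebra_cocycle (gconst al be) (Econst C Om0)) :
  let pi := PLbivector C al be Om0 in
  let mul := gmul al be in
  (* smooth enough: each component is differentiable *)
  (forall (a b : 'I_n.+1) (x : 'rV[R]_n.+1), differentiable (fun y => pi y a b) x) /\
  (* bivector (antisymmetric) *)
  (forall (x : 'rV[R]_n.+1) (a b : 'I_n.+1), pi x a b = - pi x b a) /\
  (* Jacobi identity for the bracket {x^a, x^b} = pi^{ab} *)
  (forall (x : 'rV[R]_n.+1) (a b c : 'I_n.+1),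
     \sum_d (pi x a d * partial (fun y => pi y b c) d x
           + pi x b d * partial (fun y => pi y c a) d x
           + pi x c d * partial (fun y => pi y a b) d x) = 0) /\
  (* multiplicativity: the group multiplication G~ x G~ -> G~ is a Poisson map *)
  (forall (x y : 'rV[R]_n.+1) (a b : 'I_n.+1),
     pi (mul x y) a b =
       \sum_c \sum_d (partial (fun z => mul z y 0 a) c x *
                      partial (fun z => mul z y 0 b) d x * pi x c d)
     + \sum_c \sum_d (partial (fun z => mul x z 0 a) c y *
                      partial (fun z => mul x z 0 b) d y * pi y c d)) /\
  (* its cocycle at the identity e = 0 is delta: d_e pi^{ab} = [x^a, x^b]_(E) *)
  (forall (a b c : 'I_n.+1), partial (fun y => pi y a b) c 0 = Econst C Om0 a b c).
Proof.
move=> pi mul.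
have Om0T : Om0^T = - Om0 by apply/matrixP => i j; rewrite !mxE Om0_anti.
have OmT t i j : Omega al be Om0 t i j = - Omega al be Om0 t j i.
  by have /matrixP/(_ j i) := Omega_tr al be t Om0T; rewrite mxE [RHS]mxE.
have brT w : (bracket_mx C w)^T = - bracket_mx C w.
  apply/matrixP => i j; rewrite !mxE -sumrN; apply: eq_bigr => k _.
  by rewrite C_anti mulNr.
split; first by move=> a b x; exact: differentiable_PLbivector.
split.
  move=> x a b; rewrite /pi.
  case: (unliftP ord0 a) => [i ->|->]; last by rewrite PLbivector0l PLbivector0r oppr0.
  case: (unliftP ord0 b) => [j ->|->]; last by rewrite PLbivector0l PLbivector0r oppr0.
  rewrite !PLbivector_lift.
  have /matrixP/(_ j i) : (Omega al be Om0 (hc x) + bracket_mx C (vcol x))^T =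
      - (Omega al be Om0 (hc x) + bracket_mx C (vcol x)).
    by rewrite linearD /= brT Omega_tr// opprD.
  by rewrite mxE [X in _ = X -> _]mxE.
split.
  move=> x a b c.
  case: (unliftP ord0 a) => [i ->|->]; last first.
    rewrite big1// => d _; rewrite PLbivector0l partial_PLbivector0l partial_PLbivector0r.
    by rewrite mul0r !mulr0 !addr0.
  case: (unliftP ord0 b) => [j ->|->]; last first.
    rewrite big1// => d _; rewrite PLbivector0l partial_PLbivector0l partial_PLbivector0r.
    by rewrite mul0r !mulr0 !addr0.
  case: (unliftP ord0 c) => [l ->|->]; last first.
    rewrite big1// => d _; rewrite PLbivector0l partial_PLbivector0l partial_PLbivector0r.
    by rewrite mul0r !mulr0 !addr0.
  (* The [d = ord0] term vanishes as h^1 is central, so the derivative of Omega never enters the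
     Jacobi identity. *)
  rewrite big_ord_recl !PLbivector0r !mul0r !add0r.
  under eq_bigr do rewrite !partial_PLbivector_lift !PLbivector_lift.
  have cO := Omega_cocycle2 (hc x) al_der be_der Om0_cocycle i j l.
  (* The constant part is the cocycle identity of Omega, the part linear in the coordinates is the
     Jacobi identity of V; the signs come from antisymmetry. *)
  transitivity (- \sum_k (C i j k * Omega al be Om0 (hc x) k l +
      C j l k * Omega al be Om0 (hc x) k i + C l i k * Omega al be Om0 (hc x) k j)
    - \sum_m \sum_k (C i j k * C k l m + C j l k * C k i m + C l i k * C k j m) * vc x m).
    rewrite exchange_big -!sumrN -big_split; apply: eq_bigr => k _ /=.
    have PLE p : (Omega al be Om0 (hc x) + bracket_mx C (vcol x)) p k =
        - Omega al be Om0 (hc x) k p - \sum_m C k p m * vc x m.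
      rewrite [LHS]mxE [X in X + _]OmT -sumrN; congr (_ + _).
      by rewrite mxE; apply: eq_bigr => m _; rewrite C_anti mulNr mxE.
    rewrite !PLE.
    rewrite [X in _ = _ - X](_ : _ = C i j k * (\sum_m C k l m * vc x m) +
        C j l k * (\sum_m C k i m * vc x m) + C l i k * (\sum_m C k j m * vc x m)).
      by ring.
    rewrite !mulr_sumr -!big_split; apply: eq_bigr => m _ /=; ring.
  rewrite cO oppr0 add0r big1 ?oppr0// => m _.
  by rewrite -mulr_suml C_jacobi mul0r.
split.
  move=> x y a b.
  (* Restricts the push-forward sums to the v-directions. *)
  have red P Q z : (forall d, pi z ord0 d = 0) -> (forall c, pi z c ord0 = 0) ->
      \sum_c \sum_d (P c * Q d * pi z c d) =
      \sum_k \sum_l (P (lift ord0 k) * Q (lift ord0 l) * pi z (lift ord0 k) (lift ord0 l)).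
    move=> p0 p0'; rewrite big_ord_recl big1 ?add0r => [|d _]; last by rewrite p0 mulr0.
    by apply: eq_bigr => k _; rewrite big_ord_recl p0' mulr0 add0r.
  rewrite !red; try by move=> ?; rewrite /pi ?PLbivector0l ?PLbivector0r.
  case: (unliftP ord0 a) => [i ->|->]; last first.
    rewrite /pi PLbivector0l !big1 ?addr0// => k _; rewrite big1// => l _.
      by rewrite partial_gmul_h_r !mul0r.
    by rewrite partial_gmul_h_l !mul0r.
  case: (unliftP ord0 b) => [j ->|->]; last first.
    rewrite /pi PLbivector0r !big1 ?addr0// => k _; rewrite big1// => l _.
      by rewrite partial_gmul_h_r mulr0 mul0r.
    by rewrite partial_gmul_h_l mulr0 mul0r.
  (* The push-forward of a bivector by a linear map [E] is a congruence of matrices. *)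
  have conj (E W : 'M[R]_n) : \sum_k \sum_l (E i k * E j l * W k l) = (E *m W *m E^T) i j.
    rewrite mxE exchange_big; apply: eq_bigr => l _; rewrite !mxE mulr_suml.
    by apply: eq_bigr => k _; rewrite mulrAC.
  under eq_bigr do under eq_bigr do rewrite !partial_gmul_v_l PLbivector_lift.
  under [X in _ = _ + X]eq_bigr do under eq_bigr do rewrite !partial_gmul_v_r PLbivector_lift.
  (* Omega splits by its addition law and the linear part by the group law; the linear summands are
     swapped so that the contribution of [x] comes first in both. *)
  rewrite !conj /pi PLbivector_lift gmul_h gmul_v Omega_add//
    bracket_mx_add [bracket_mx _ _ + _]addrC.
  have mE D t : lie_derivation C D -> lie_morphism C (expm (t *: D)).
    exact: lie_morphism_expm.
  rewrite (mE _ _ al_der) (mE _ _ be_der) !mulmxDr !mulmxDl.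
  have addE (X Y : 'M[R]_n) : X i j + Y i j = (X + Y) i j by rewrite mxE.
  by rewrite addE [in RHS]addrACA.
move=> a b c; rewrite /pi /Econst.
case: (unliftP ord0 a) => [i ->|->]; last exact: partial_PLbivector0l.
case: (unliftP ord0 b) => [j ->|->]; last exact: partial_PLbivector0r.
case: (unliftP ord0 c) => [k ->|->]; first exact: partial_PLbivector_lift.
exact: partial_PLbivector_h.
Qed.
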